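(* Let $a>b>0$ be integers and let $f_0$ be defined by $f_0(1)=1$, $f_0(2)=a$, and $f_0(n+2)=af_0(n+1)-bf_0(n)$ for $n\ge 1$. Then for every $n\ge 1$, the number $f_0(n)$ is the number of words of length $n-1$ over the alphabet $\{0,1,\ldots,a-1\}$ avoiding the subwords $0i$, $i=1,\ldots,b$.
   Context: A subword means a block of consecutive letters; so avoiding $0i$ means that the letter $0$ is never immediately followed by the letter $i$. The empty word is the unique word of length $0$. *)

(* Defs.v *)
From HB Require Import structures.
From mathcomp Require Import all_boot all_order all_algebra.
Set Implicit Arguments.
Unset Strict Implicit.
Unset Printing Implicit Defensive.

(* The letters of w are read as natural numbers, so that the forbidden       *)
(* subwords 0i need no proof that 0 and i belong to the alphabet 'I_a.       *)
(* [infix] is containment as a block of consecutive letters.                 *)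
Definition avoids_0i (a b : nat) (w : seq 'I_a) : bool :=
  all (fun i : nat => ~~ infix [:: 0; i] (map val w)) (iota 1 b).

(* Main.v *)
Require Import Defs.
From HB Require Import structures.
From mathcomp Require Import all_boot all_order all_algebra.
Set Implicit Arguments.
Unset Strict Implicit.
Unset Printing Implicit Defensive.
Import Order.TTheory GRing.Theory Num.Theory.

(** Write [N m] for the number of avoiding words of length [m]. It suffices that
    [N 0 = 1], [N 1 = a] and [N (m + 2) + b * N m = a * N (m + 1)].
    For the last identity ([num_avoiding_rec]), put an arbitrary letter [x] in
    front of an avoiding word [w] of length [m + 1]; there are [a * N (m + 1)]
    such pairs. Either [x :: w] avoids again, and each avoiding word of length
    [m + 2] arises once in this way, or a forbidden block sits at the very front:
    [x = 0] and [w = i :: v] with [1 <= i <= b]. Since such an [i] is not [0],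
    no forbidden block can start at [i], so [w] avoids exactly when [v] does
    ([avoids_0i_cons]): there are [b * N m] pairs of the second kind. *)

Definition num_avoiding (a b n : nat) : nat :=
  \sum_(w : n.-tuple 'I_a) avoids_0i b w.

Definition starts_1b (b : nat) a (w : seq 'I_a) : bool :=
  if w is i :: _ then (0 < i <= b) else false.

Lemma big_tuple_cons (T : finType) n (F : seq T -> nat) :
  (\sum_(w : n.+1.-tuple T) F w = \sum_(x : T) \sum_(w : n.-tuple T) F (x :: w)).
Proof.
rewrite pair_big /=.
rewrite (reindex (fun p : T * n.-tuple T => cons_tuple p.1 p.2)) //=.
exists (fun w : n.+1.-tuple T => (thead w, behead_tuple w)) => [[x w] _ | w _].
  by congr pair; apply: val_inj.
by rewrite [RHS]tuple_eta; apply: val_inj.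
Qed.

(** A block of length two in [x :: w] either lies in [w] or is the prefix of
    length two, so avoidance can be decided letter by letter. *)
Lemma avoids_0i_cons a b (x : 'I_a) (w : seq 'I_a) :
  avoids_0i b (x :: w) =
    ~~ ((x == 0 :> nat) && starts_1b b w) && avoids_0i b w.
Proof.
rewrite /avoids_0i.
have -> : (x == 0 :> nat) && starts_1b b w
    = has (fun i : nat => prefix [:: 0; i] (map val (x :: w))) (iota 1 b).
  case: w => [|j w]; rewrite /= ?andbF.
    by apply/esym/hasPn => i _; rewrite /= ?andbF.
  rewrite eq_sym; case: (0 == x) => /=; last by apply/esym/hasPn.
  apply/idP/hasP => [hj | [i]].
    by exists (val j); rewrite ?eqxx ?prefix0s // mem_iota add1n ltnS.
  by rewrite mem_iota add1n ltnS prefix0s andbT => hi /eqP <-.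
rewrite -all_predC -all_predI; apply: eq_all => i /=.
by rewrite negb_or.
Qed.

Lemma num_avoiding0 a b : num_avoiding a b 0 = 1.
Proof.
rewrite /num_avoiding (big_pred1 [tuple]) => [|w].
  by rewrite (_ : avoids_0i b _) //; apply/allP.
by apply/esym/eqP; apply: tuple0.
Qed.

Lemma num_avoiding1 a b : num_avoiding a b 1 = a.
Proof.
rewrite /num_avoiding (eq_bigr (fun=> 1)) => [|w _].
  by rewrite sum1_card card_tuple card_ord expn1.
case/tupleP: w => x w; rewrite /= (tuple0 w) avoids_0i_cons andbF.
by rewrite (_ : avoids_0i b _) //; apply/allP.
Qed.

Lemma sum_ord_1b a b : b < a -> (\sum_(i < a) (0 < i <= b) = b).
Proof.
move=> hab; rewrite -(big_mkord xpredT (fun i => (0 < i <= b) : nat)).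
rewrite (big_cat_nat (n := b.+1)) //= big_ltn // add0n.
rewrite [X in (_ + X)]big_nat_cond [X in (_ + X)]big1 ?addn0.
  rewrite big_nat_cond (eq_bigr (fun=> 1)) => [|i].
    by rewrite -big_nat_cond sum_nat_const_nat muln1 subn1.
  by rewrite andbT ltnS => ->.
by move=> i /andP[/andP[hi _] _]; rewrite (leqNgt i b) hi andbF.
Qed.

(** Removing a first letter between [1] and [b] does not affect avoidance, as
    that letter is not [0]; the hypothesis [b < a] makes all [b] such letters
    available in the alphabet. *)
Lemma num_avoiding_starts_1b a b n : b < a ->
  (\sum_(w : n.+1.-tuple 'I_a) (starts_1b b w && avoids_0i b w)
   = b * num_avoiding a b n).
Proof.
move=> hab.
rewrite (big_tuple_cons _ (fun w => (starts_1b b w && avoids_0i b w) : nat)).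
rewrite -[X in _ = X * _](sum_ord_1b hab) big_distrl /=; apply: eq_bigr => i _.
rewrite big_distrr /=; apply: eq_bigr => v _.
by rewrite mulnb avoids_0i_cons; case: (posnP i) => [-> |].
Qed.

(** The relation is stated additively to stay within natural numbers, where
    subtraction is truncated. *)
Lemma num_avoiding_rec a b n : b < a ->
  (num_avoiding a b n.+2 + b * num_avoiding a b n
   = a * num_avoiding a b n.+1).
Proof.
move=> hab; rewrite -num_avoiding_starts_1b //.
have a_gt0 : 0 < a := leq_ltn_trans (leq0n b) hab.
(* Spread the second term over all first letters [x]; only [x = 0] contributes.
   Both sides then agree for each pair of [x] and [w] separately. *)
rewrite (_ : \sum_(w : n.+1.-tuple 'I_a) _ = \sum_(x < a)
    \sum_(w : n.+1.-tuple 'I_a)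
      ((x == 0 :> nat) && (starts_1b b w && avoids_0i b w))); last first.
  rewrite (bigD1 (Ordinal a_gt0)) //= [X in (_ + X)]big1 ?addn0 // => x x_neq0.
  apply: big1 => w _.
  by rewrite -[x == 0 :> nat]/(x == Ordinal a_gt0) (negPf x_neq0).
rewrite {1}/num_avoiding (big_tuple_cons _ (fun w => avoids_0i b w : nat)).
rewrite -big_split /=.
rewrite -[X in (_ = X * _)](card_ord a) -sum_nat_const.
apply: eq_bigr => x _; rewrite -big_split; apply: eq_bigr => w _ /=.
by rewrite avoids_0i_cons; case: (x == 0 :> nat) (starts_1b b w) (avoids_0i b w)
  => [] [] [].
Qed.

Local Open Scope ring_scope.

Theorem proposition9 (a b : nat) (f0 : nat -> int) (hb : (0 < b)%N)
    (hab : (b < a)%N) (hf1 : f0 1%N = 1) (hf2 : f0 2%N = a%:Z)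
    (hf : forall n : nat, (1 <= n)%N ->
       f0 n.+2 = a%:Z * f0 n.+1 - b%:Z * f0 n) :
  forall n : nat, (1 <= n)%N ->
    f0 n = #|[set w : (n - 1).-tuple 'I_a | avoids_0i b w]|%:Z.
Proof.
case=> // n _; rewrite subn1 /=.
have -> : #|[set w : n.-tuple 'I_a | avoids_0i b w]| = num_avoiding a b n.
  rewrite -sum1_card big_mkcond; apply: eq_bigr => w _.
  by rewrite inE; case: avoids_0i.
(* The recurrence has order two, so two consecutive values are carried along. *)
suff [] : f0 n.+1 = (num_avoiding a b n)%:Z /\
          f0 n.+2 = (num_avoiding a b n.+1)%:Z by [].
elim: n => [|n [IH0 IH1]]; first by rewrite hf1 hf2 num_avoiding0 num_avoiding1.
split=> //; rewrite hf // IH0 IH1 -!PoszM -num_avoiding_rec //.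
by rewrite PoszD addrK.
Qed.
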